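(* Let $(\mathcal C,T,\eta,\mu,s,\sigma:T\Omega\to\Omega,\omega:1\to\Omega)$ be a let-ccc with a fixpoint object. Put $\blacktriangleright=T$, with point $p=\eta:\mathrm{Id}\to T$, and for every $f:Y\times TX\to X$ define $f^\dagger=\mathsf{it}(f)\cdot(Y\times\omega):Y\cong Y\times 1\to X$. Then $\dagger$ satisfies the fixpoint identity, the parameter identity, the composition identity and uniformity, i.e.: ($\dagger$) for every $f:Y\times TX\to X$: $f^\dagger=f\cdot(Y\times\eta_X)\cdot\langle Y,f^\dagger\rangle$; (P) for every $f:Y\times TX\to X$ and $h:Z\to Y$: $f^\dagger\cdot h=(f\cdot(h\times TX))^\dagger$; (C) for every $f:Y\times TX\to Z$ and $g:Z\to X$: $(g\cdot f)^\dagger=g\cdot(f\cdot(Y\times Tg))^\dagger$; (U) for every $f:Y\times TX\to X$, $g:Y\times TX'\to X'$ and $h:X\to X'$: if $h\cdot f=g\cdot(Y\times Th)$, then $h\cdot f^\dagger=g^\dagger$.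
   Context: Notation: objects also denote their identity morphisms; $g\cdot f$ is composition ($f$ first); $\pi_\ell$ is the left product projection; $1$ is the terminal object. A let-ccc with a fixpoint object (Crole–Pitts) is a tuple $(\mathcal C,T,\eta,\mu,s,\sigma,\omega)$ where: $\mathcal C$ is a cartesian closed category; $(T,\eta,\mu,s)$ is a strong monad on $\mathcal C$, i.e. a monad with a strength $s_{A,B}:A\times TB\to T(A\times B)$ natural in $A,B$ and compatible with the monad structure in the usual way; $\sigma:T\Omega\to\Omega$ is an initial algebra for the functor $T$; and $\omega:1\to\Omega$ is the equalizer of $\sigma\cdot\eta_\Omega$ and $\mathrm{id}_\Omega$. For $f:A\times B\to TC$ put $f^*=\mu_C\cdot Tf\cdot s_{A,B}:A\times TB\to TC$. By initiality of $\Omega$ and cartesian closedness, for every $f:C\times TA\to A$ there is a unique morphism $\mathsf{it}(f):C\times\Omega\to A$ with $$\mathsf{it}(f)\cdot(C\times\sigma)=f\cdot\langle\pi_\ell,(\eta_A\cdot\mathsf{it}(f))^*\rangle:C\times T\Omega\to A .$$ *)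

(* Defs.v *)
Set Implicit Arguments.
Unset Strict Implicit.
Unset Printing Implicit Defensive.

Declare Scope cat_scope.
Delimit Scope cat_scope with cat.
Local Open Scope cat_scope.

(* Universal properties are given by chosen structure: an operation producing
   the mediating morphism, together with its equation and its uniqueness. *)

Record category := Category {
  obj :> Type;
  hom : obj -> obj -> Type;
  id : forall A, hom A A;
  comp : forall A B C, hom B C -> hom A B -> hom A C;
  comp_idl : forall A B (f : hom A B), comp (id B) f = f;
  comp_idr : forall A B (f : hom A B), comp f (id A) = f;
  comp_assoc : forall A B C D (h : hom C D) (g : hom B C) (f : hom A B),
    comp h (comp g f) = comp (comp h g) f
}.
Arguments hom {c} A B.
Arguments id {c} A.
Arguments comp {c A B C} g f.

Notation "A ~> B" := (hom A B) (at level 70, no associativity) : cat_scope.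
Notation "g ∘ f" := (comp g f) (at level 40, left associativity) : cat_scope.

Record cart_category := CartCategory {
  cart_cat :> category;
  one : cart_cat;
  bang : forall A, A ~> one;
  bang_unique : forall A (u : A ~> one), u = bang A;
  prod : cart_cat -> cart_cat -> cart_cat;
  projl : forall A B, prod A B ~> A;
  projr : forall A B, prod A B ~> B;
  pair : forall X A B, (X ~> A) -> (X ~> B) -> (X ~> prod A B);
  projl_pair : forall X A B (f : X ~> A) (g : X ~> B),
    projl A B ∘ pair f g = f;
  projr_pair : forall X A B (f : X ~> A) (g : X ~> B),
    projr A B ∘ pair f g = g;
  pair_unique : forall X A B (f : X ~> A) (g : X ~> B) (h : X ~> prod A B),
    projl A B ∘ h = f -> projr A B ∘ h = g -> h = pair f g
}.
Arguments one {c}.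
Arguments bang {c} A.
Arguments prod {c} A B.
Arguments projl {c} A B.
Arguments projr {c} A B.
Arguments pair {c X A B} f g.

Notation "A × B" := (prod A B) (at level 39, left associativity) : cat_scope.
Notation "⟨ f , g ⟩" := (pair f g) (at level 0) : cat_scope.

Definition prod_map (C : cart_category) (A A' B B' : C)
    (f : A ~> A') (g : B ~> B') : A × B ~> A' × B' :=
  ⟨ f ∘ projl A B , g ∘ projr A B ⟩.

Notation "f ⊗ g" := (prod_map f g) (at level 39, left associativity)
  : cat_scope.

Definition prod_assoc (C : cart_category) (A B D : C) :
    (A × B) × D ~> A × (B × D) :=
  ⟨ projl A B ∘ projl (A × B) D ,
    ⟨ projr A B ∘ projl (A × B) D , projr (A × B) D ⟩ ⟩.

Record ccc := CCC {
  ccc_cart :> cart_category;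
  expo : ccc_cart -> ccc_cart -> ccc_cart;
  eval : forall A B, A × expo A B ~> B;
  curry : forall A B X, (A × X ~> B) -> (X ~> expo A B);
  eval_curry : forall A B X (f : A × X ~> B),
    eval A B ∘ (id A ⊗ curry f) = f;
  curry_unique : forall A B X (f : A × X ~> B) (k : X ~> expo A B),
    eval A B ∘ (id A ⊗ k) = f -> k = curry f
}.
Arguments expo {c} A B.
Arguments eval {c} A B.
Arguments curry {c A B X} f.

Record functor (C D : category) := Functor {
  fobj :> C -> D;
  fmap : forall A B, (A ~> B) -> (fobj A ~> fobj B);
  fmap_id : forall A, fmap (id A) = id (fobj A);
  fmap_comp : forall A B E (g : B ~> E) (f : A ~> B),
    fmap (g ∘ f) = fmap g ∘ fmap f
}.
Arguments fmap {C D} f {A B} _ : rename.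

Record monad (C : category) := Monad {
  monad_functor :> functor C C;
  unit : forall A, A ~> monad_functor A;
  mult : forall A, monad_functor (monad_functor A) ~> monad_functor A;
  unit_natural : forall A B (f : A ~> B),
    fmap monad_functor f ∘ unit A = unit B ∘ f;
  mult_natural : forall A B (f : A ~> B),
    fmap monad_functor f ∘ mult A =
    mult B ∘ fmap monad_functor (fmap monad_functor f);
  mult_unitl : forall A, mult A ∘ unit (monad_functor A) = id _;
  mult_unitr : forall A, mult A ∘ fmap monad_functor (unit A) = id _;
  mult_assoc : forall A,
    mult A ∘ mult (monad_functor A) = mult A ∘ fmap monad_functor (mult A)
}.
Arguments unit {C} m A.
Arguments mult {C} m A.

Record strong_monad (C : cart_category) := StrongMonad {
  strong_monad_monad :> monad C;
  strength : forall A B : C,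
    A × strong_monad_monad B ~> strong_monad_monad (A × B);
  strength_natural : forall (A A' B B' : C) (f : A ~> A') (g : B ~> B'),
    fmap strong_monad_monad (f ⊗ g) ∘ strength A B =
    strength A' B' ∘ (f ⊗ fmap strong_monad_monad g);
  strength_one : forall A : C,
    fmap strong_monad_monad (projr one A) ∘ strength one A =
    projr one (strong_monad_monad A);
  strength_assoc : forall A B D : C,
    fmap strong_monad_monad (prod_assoc A B D) ∘ strength (A × B) D =
    strength A (B × D) ∘ (id A ⊗ strength B D)
      ∘ prod_assoc A B (strong_monad_monad D);
  strength_unit : forall A B : C,
    strength A B ∘ (id A ⊗ unit strong_monad_monad B) =
    unit strong_monad_monad (A × B);
  strength_mult : forall A B : C,
    strength A B ∘ (id A ⊗ mult strong_monad_monad B) =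
    mult strong_monad_monad (A × B)
      ∘ fmap strong_monad_monad (strength A B)
      ∘ strength A (strong_monad_monad B)
}.
Arguments strength {C} s A B.

Record initial_algebra (C : category) (F : functor C C) := InitialAlgebra {
  carrier : C;
  alg : F carrier ~> carrier;
  fold : forall A (a : F A ~> A), carrier ~> A;
  fold_alg : forall A (a : F A ~> A),
    fold a ∘ alg = a ∘ fmap F (fold a);
  fold_unique : forall A (a : F A ~> A) (h : carrier ~> A),
    h ∘ alg = a ∘ fmap F h -> h = fold a
}.

Definition is_equalizer (C : category) (E A B : C)
    (f g : A ~> B) (e : E ~> A) : Prop :=
  f ∘ e = g ∘ e /\
  forall (Z : C) (z : Z ~> A), f ∘ z = g ∘ z -> exists! u : Z ~> E, e ∘ u = z.

Record fixpoint_object (C : cart_category) (T : monad C) := FixpointObject {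
  fix_alg :> initial_algebra T;
  omega : one ~> carrier fix_alg;
  omega_equalizer :
    is_equalizer (alg fix_alg ∘ unit T (carrier fix_alg))
      (id (carrier fix_alg)) omega
}.
Arguments omega {C T} f : rename.

Record let_ccc_fix := LetCCCFix {
  let_ccc :> ccc;
  let_monad : strong_monad let_ccc;
  let_fix : fixpoint_object let_monad
}.

Notation "'T[' L ]" := (let_monad L) (at level 0, format "'T[' L ]")
  : cat_scope.
Notation "'Ω[' L ]" := (carrier (let_fix L)) (at level 0, format "'Ω[' L ]")
  : cat_scope.

Definition star (C : cart_category) (T : strong_monad C) (A B D : C)
    (f : A × B ~> T D) : A × T B ~> T D :=
  mult T D ∘ fmap T f ∘ strength T A B.

Definition is_it (L : let_ccc_fix) (C A : L) (f : C × T[L] A ~> A)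
    (k : C × Ω[L] ~> A) : Prop :=
  k ∘ (id C ⊗ alg (let_fix L)) =
  f ∘ ⟨ projl C (T[L] Ω[L]) , star (unit T[L] A ∘ k) ⟩.

Lemma pair_comp (C : cart_category) (X Y A B : C)
    (f : Y ~> A) (g : Y ~> B) (h : X ~> Y) :
  ⟨ f , g ⟩ ∘ h = ⟨ f ∘ h , g ∘ h ⟩.
Proof.
  apply pair_unique; rewrite comp_assoc.
  - now rewrite projl_pair.
  - now rewrite projr_pair.
Qed.

Lemma prod_map_pair (C : cart_category) (X A A' B B' : C)
    (f : A ~> A') (g : B ~> B') (u : X ~> A) (v : X ~> B) :
  (f ⊗ g) ∘ ⟨ u , v ⟩ = ⟨ f ∘ u , g ∘ v ⟩.
Proof.
  unfold prod_map.
  now rewrite pair_comp, <- !comp_assoc, projl_pair, projr_pair.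
Qed.

Lemma prod_map_comp (C : cart_category) (A A' A'' B B' B'' : C)
    (f' : A' ~> A'') (f : A ~> A') (g' : B' ~> B'') (g : B ~> B') :
  (f' ⊗ g') ∘ (f ⊗ g) = (f' ∘ f) ⊗ (g' ∘ g).
Proof.
  unfold prod_map at 2.
  now rewrite prod_map_pair, !comp_assoc.
Qed.

Lemma eval_inj (C : ccc) (A B X : C) (k k' : X ~> expo A B) :
  eval A B ∘ (id A ⊗ k) = eval A B ∘ (id A ⊗ k') -> k = k'.
Proof.
  intros H. rewrite (curry_unique H). symmetry. now apply curry_unique.
Qed.

Lemma star_unit (C : cart_category) (T : strong_monad C) (A B D : C)
    (k : A × B ~> D) :
  star (unit T D ∘ k) = fmap T k ∘ strength T A B.
Proof.
  unfold star.
  now rewrite fmap_comp, (comp_assoc (mult T D)), mult_unitr, comp_idl.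
Qed.

(* With C × Ω ~> A transposed to Ω ~> A^C, [is_it f] says that the transpose
   is an algebra morphism into this algebra on A^C. *)
Definition it_alg (L : let_ccc_fix) (C A : L) (f : C × T[L] A ~> A) :
    T[L] (expo C A) ~> expo C A :=
  curry (f ∘ ⟨ projl C (T[L] (expo C A)) ,
               fmap T[L] (eval C A) ∘ strength T[L] C (expo C A) ⟩).

Lemma is_it_transpose (L : let_ccc_fix) (C A : L) (f : C × T[L] A ~> A)
    (k : Ω[L] ~> expo C A) :
  is_it f (eval C A ∘ (id C ⊗ k)) <->
  k ∘ alg (let_fix L) = it_alg f ∘ fmap T[L] k.
Proof.
  assert (El : eval C A ∘ (id C ⊗ (k ∘ alg (let_fix L))) =
    eval C A ∘ (id C ⊗ k) ∘ (id C ⊗ alg (let_fix L))).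
  { now rewrite <- comp_assoc, prod_map_comp, comp_idl. }
  assert (Er : eval C A ∘ (id C ⊗ (it_alg f ∘ fmap T[L] k)) =
    f ∘ ⟨ projl C (T[L] Ω[L]) ,
          star (unit T[L] A ∘ (eval C A ∘ (id C ⊗ k))) ⟩).
  { transitivity (eval C A ∘ ((id C ⊗ it_alg f) ∘ (id C ⊗ fmap T[L] k))).
    { now rewrite prod_map_comp, comp_idl. }
    unfold it_alg at 1.
    rewrite comp_assoc, eval_curry, <- comp_assoc, pair_comp.
    rewrite star_unit, fmap_comp, <- !comp_assoc, strength_natural.
    f_equal; f_equal. unfold prod_map. now rewrite projl_pair, comp_idl. }
  unfold is_it. rewrite <- El, <- Er. split.
  - apply eval_inj.
  - now intros ->.
Qed.

Lemma it_unique_existence (L : let_ccc_fix) (C A : L) (f : C × T[L] A ~> A) :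
  {k : C × Ω[L] ~> A | unique (is_it f) k}.
Proof.
  exists (eval C A ∘ (id C ⊗ fold (let_fix L) (it_alg f))). split.
  - apply is_it_transpose, fold_alg.
  - intros k Hk. rewrite <- (eval_curry k) in Hk |- *.
    apply is_it_transpose in Hk. now rewrite (fold_unique Hk).
Qed.

Definition it (L : let_ccc_fix) (C A : L) (f : C × T[L] A ~> A) :
    C × Ω[L] ~> A :=
  proj1_sig (it_unique_existence f).

Definition dagger (L : let_ccc_fix) (Y X : L) (f : Y × T[L] X ~> X) : Y ~> X :=
  it f ∘ (id Y ⊗ omega (let_fix L)) ∘ ⟨ id Y , bang Y ⟩.

(* Main.v *)
(** Uniqueness of [it f] transports any identity that holds for the recursive
    equation: postcomposing a solution with an algebra-like map gives uniformity,
    precomposing it with [h] on parameters gives the parameter identity.  The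
    fixpoint identity is the recursive equation at [ω = σ ∘ η ∘ ω], where the
    strength is computed by its unit law; the composition identity is the
    instance of uniformity where [g] itself is the comparison map. *)
Require Import Defs.
Local Open Scope cat_scope.

Lemma it_unique (L : let_ccc_fix) (C A : L) (f : C × T[L] A ~> A)
    (k : C × Ω[L] ~> A) :
  is_it f k -> it f = k.
Proof. exact (proj2 (proj2_sig (it_unique_existence f)) k). Qed.

(** A unit law of the monad cancels the multiplication inside [star], so later arguments handle only
    functoriality and the strength. *)
Lemma is_itE (L : let_ccc_fix) (C A : L) (f : C × T[L] A ~> A)
    (k : C × Ω[L] ~> A) :
  is_it f k <->
  k ∘ (id C ⊗ alg (let_fix L)) =
  f ∘ ⟨ projl C (T[L] Ω[L]) , fmap T[L] k ∘ strength T[L] C Ω[L] ⟩.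
Proof. unfold is_it. now rewrite star_unit. Qed.

Lemma it_alg_eq (L : let_ccc_fix) (C A : L) (f : C × T[L] A ~> A) :
  it f ∘ (id C ⊗ alg (let_fix L)) =
  f ∘ ⟨ projl C (T[L] Ω[L]) , fmap T[L] (it f) ∘ strength T[L] C Ω[L] ⟩.
Proof. apply is_itE. exact (proj1 (proj2_sig (it_unique_existence f))). Qed.

Lemma strength_pair_unit (C : cart_category) (T : strong_monad C) (X A B : C)
    (u : X ~> A) (v : X ~> B) :
  strength T A B ∘ ⟨ u , unit T B ∘ v ⟩ = unit T (A × B) ∘ ⟨ u , v ⟩.
Proof.
  now rewrite <- strength_unit, <- comp_assoc, prod_map_pair, comp_idl.
Qed.

(** Absorbing Y ≅ Y × 1 leaves a single pairing with the constant [omega], on which the product laws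
    act directly. *)
Lemma daggerE (L : let_ccc_fix) (Y X : L) (f : Y × T[L] X ~> X) :
  dagger f = it f ∘ ⟨ id Y , omega (let_fix L) ∘ bang Y ⟩.
Proof.
  unfold dagger. now rewrite <- comp_assoc, prod_map_pair, comp_idl.
Qed.

Lemma it_uniform (L : let_ccc_fix) (X X' Y : L) (f : Y × T[L] X ~> X)
    (g : Y × T[L] X' ~> X') (h : X ~> X') :
  h ∘ f = g ∘ (id Y ⊗ fmap T[L] h) -> it g = h ∘ it f.
Proof.
  intros H. apply it_unique, is_itE.
  rewrite <- comp_assoc, it_alg_eq, comp_assoc, H.
  now rewrite <- comp_assoc, prod_map_pair, comp_idl, fmap_comp, comp_assoc.
Qed.

(** Naturality of the strength in the parameter lets the reindexed solution solve the reindexed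
    equation. *)
Lemma it_parameter (L : let_ccc_fix) (X Y Z : L) (f : Y × T[L] X ~> X)
    (h : Z ~> Y) :
  it (f ∘ (h ⊗ id (T[L] X))) = it f ∘ (h ⊗ id Ω[L]).
Proof.
  apply it_unique, is_itE.
  (* [h] and [alg] act on different factors; swapping them exposes the left side of [it_alg_eq]. *)
  transitivity (it f ∘ (id Y ⊗ alg (let_fix L)) ∘ (h ⊗ id (T[L] Ω[L]))).
  { now rewrite <- !comp_assoc, !prod_map_comp, !comp_idl, !comp_idr. }
  rewrite it_alg_eq, <- !comp_assoc, prod_map_pair.
  rewrite comp_idl, fmap_comp, <- comp_assoc, strength_natural, fmap_id.
  rewrite pair_comp, comp_assoc.
  unfold prod_map at 1. now rewrite projl_pair.
Qed.

Lemma dagger_fixpoint (L : let_ccc_fix) (X Y : L) (f : Y × T[L] X ~> X) :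
  dagger f = f ∘ (id Y ⊗ unit T[L] X) ∘ ⟨ id Y , dagger f ⟩.
Proof.
  assert (Ho : alg (let_fix L) ∘ unit T[L] Ω[L] ∘ omega (let_fix L) =
    omega (let_fix L)).
  { destruct (omega_equalizer (let_fix L)) as [Ho _].
    now rewrite comp_idl in Ho. }
  transitivity (it f ∘ ⟨ id Y , omega (let_fix L) ∘ bang Y ⟩); [apply daggerE|].
  (* Expanding ω to σ ∘ η ∘ ω by [Ho] produces the [alg] that the recursive equation consumes. *)
  transitivity (it f ∘ (id Y ⊗ alg (let_fix L))
    ∘ ⟨ id Y , unit T[L] Ω[L] ∘ (omega (let_fix L) ∘ bang Y) ⟩).
  { rewrite <- comp_assoc, prod_map_pair, comp_idl.
    now rewrite !comp_assoc, Ho. }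
  rewrite it_alg_eq, <- !comp_assoc, pair_comp.
  rewrite projl_pair, <- (comp_assoc (fmap _ _)), strength_pair_unit.
  rewrite comp_assoc, unit_natural, <- comp_assoc, <- daggerE.
  now rewrite prod_map_pair, comp_idl.
Qed.

Lemma dagger_parameter (L : let_ccc_fix) (X Y Z : L) (f : Y × T[L] X ~> X)
    (h : Z ~> Y) :
  dagger f ∘ h = dagger (f ∘ (h ⊗ id (T[L] X))).
Proof.
  rewrite !daggerE, it_parameter, <- !comp_assoc, prod_map_pair, pair_comp.
  rewrite !comp_idl, comp_idr, <- comp_assoc.
  (* The constant ω ignores reindexing along [h], since 1 is terminal. *)
  now rewrite (bang_unique (bang Y ∘ h)).
Qed.

Lemma dagger_uniform (L : let_ccc_fix) (X X' Y : L) (f : Y × T[L] X ~> X)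
    (g : Y × T[L] X' ~> X') (h : X ~> X') :
  h ∘ f = g ∘ (id Y ⊗ fmap T[L] h) -> h ∘ dagger f = dagger g.
Proof.
  intros H. apply it_uniform in H. now rewrite !daggerE, H, comp_assoc.
Qed.

Theorem theorem3p6 (L : let_ccc_fix) :
  (forall (X Y : L) (f : Y × T[L] X ~> X),
     dagger f = f ∘ (id Y ⊗ unit T[L] X) ∘ ⟨ id Y , dagger f ⟩)
  /\
  (forall (X Y Z : L) (f : Y × T[L] X ~> X) (h : Z ~> Y),
     dagger f ∘ h = dagger (f ∘ (h ⊗ id (T[L] X))))
  /\
  (forall (X Y Z : L) (f : Y × T[L] X ~> Z) (g : Z ~> X),
     dagger (g ∘ f) = g ∘ dagger (f ∘ (id Y ⊗ fmap T[L] g)))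
  /\
  (forall (X X' Y : L) (f : Y × T[L] X ~> X) (g : Y × T[L] X' ~> X')
     (h : X ~> X'),
     h ∘ f = g ∘ (id Y ⊗ fmap T[L] h) -> h ∘ dagger f = dagger g).
Proof.
  split; [|split; [|split]].
  - intros; apply dagger_fixpoint.
  - intros; apply dagger_parameter.
  (* With [g] as comparison map, the premise of uniformity is plain associativity. *)
  - intros X Y Z f g. symmetry. apply dagger_uniform, comp_assoc.
  - intros X X' Y f g h; apply dagger_uniform.
Qed.
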